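(* Let $n,k$ be integers with $4\le k\le n-1$, and let $\mathcal X\subset\mathbb R^2$ be an $n$-independent set of nodes with $\#\mathcal X=d(n,k-3)+3$. Then there are at most seven linearly independent polynomials in $\Pi_k$ vanishing at all nodes of $\mathcal X$ (i.e. $\dim\{p\in\Pi_k: p|_{\mathcal X}=0\}\le 7$). Moreover, there are seven such linearly independent polynomials if and only if all the nodes of $\mathcal X$ but three lie in a curve of degree $k-3$ (which is then a maximal curve for $\mathcal X$).
   Context: $\Pi_n$ denotes the space of real bivariate polynomials of total degree at most $n$; $N_n=\dim\Pi_n=\frac12(n+1)(n+2)$, and $d(n,k):=N_n-N_{n-k}=\frac12 k(2n+3-k)$. A curve of degree $k$ is identified with a polynomial $p$ of degree $k$ (the curve being $\{p=0\}$); a curve passes through a node if the polynomial vanishes there, and ''linearly independent curves'' means linearly independent polynomials. For a finite node set $\mathcal X$ and $A\in\mathcal X$, a polynomial $p\in\Pi_n$ is an $n$-fundamental polynomial of $A$ if $p(A)=1$ and $p$ vanishes on $\mathcal X\setminus\{A\}$. $\mathcal X$ is $n$-independent if every node of $\mathcal X$ has an $n$-fundamental polynomial. Given an $n$-independent set $\mathcal X$ with $\#\mathcal X\ge d(n,k)$, a curve of degree $k\le n$ is called maximal if it passes through exactly $d(n,k)$ nodes of $\mathcal X$. *)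

(* Defs.v *)
From mathcomp Require Import all_boot all_algebra.
From mathcomp Require Import reals.
From mathcomp Require Import mpoly.
Set Implicit Arguments. Unset Strict Implicit. Unset Printing Implicit Defensive.
Import GRing.Theory.
Local Open Scope ring_scope.

Section Defs.
Variable R : realType.

Definition ev (p : {mpoly R[2]}) (x : 'rV[R]_2) : R := p.@[fun i => x ord0 i].

(* p belongs to Pi_n : total degree at most n (msize = 1 + degree, 0 for p = 0) *)
Definition inPi (n : nat) (p : {mpoly R[2]}) : bool := (msize p <= n.+1)%N.

Definition has_degree (k : nat) (p : {mpoly R[2]}) : bool := msize p == k.+1.

(* N_n = dim Pi_n and d(n,k) = N_n - N_{n-k} *)
Definition Ndim (n : nat) : nat := ((n.+1 * n.+2) %/ 2)%N.
Definition dnk (n k : nat) : nat := (Ndim n - Ndim (n - k))%N.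

Definition fundamental (n : nat) (X : seq 'rV[R]_2) (A : 'rV[R]_2)
  (p : {mpoly R[2]}) : Prop :=
  inPi n p /\ ev p A = 1 /\ (forall B, B \in X -> B != A -> ev p B = 0).

Definition n_independent (n : nat) (X : seq 'rV[R]_2) : Prop :=
  forall A, A \in X -> exists p, fundamental n X A p.

Definition vanishes_on (p : {mpoly R[2]}) (X : seq 'rV[R]_2) : Prop :=
  forall x, x \in X -> ev p x = 0.

Definition lin_indep (ps : seq {mpoly R[2]}) : Prop :=
  forall c : 'I_(size ps) -> R,
    \sum_(i < size ps) c i *: ps`_i = 0 -> forall i, c i = 0.

End Defs.

(* Main.v *)
Require Import Defs.
From HB Require Import structures.
From mathcomp Require Import all_boot all_algebra.
From mathcomp Require Import zify ring.
From mathcomp Require boolp.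
From mathcomp Require Import reals.
From mathcomp Require Import mpoly.
Set Implicit Arguments. Unset Strict Implicit. Unset Printing Implicit Defensive.
Import GRing.Theory.
Local Open Scope ring_scope.

(** Let [P_j] be the space of polynomials of degree at most [j] vanishing on [X],
    and [l_j = dim P_j - dim P_(j-1)], the dimension of the space [L_j] of their
    leading forms of degree [j].  If [L_j <> 0] then [x L_j + y L_j] has dimension
    at least [l_j + 1], so the nonzero [l_j] increase strictly, while
    [n]-independence gives [dim P_n = N_n - #X].  Hence [dim P_k <= 7], and
    equality forces [dim P_(k-1) = 3] and [dim P_(k+1) = 12].

    In the case of equality choose coordinates such that [y^k] occurs in [P_k].
    Then [P_(k+1) = P_k + x P_k + <y w>], and all leading forms in [L_k] have
    [y]-degree at least [k - 3].  In the [R[x]]-module [M] spanned by [P_k],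
    multiplication by [y] preserves the elements of [y]-degree less than [k], and
    nonzero elements have [y]-degree at least [k - 3].  An element [G] of least
    [y]-degree therefore divides all of [P_k] over [R(x)] and, by Gauss's lemma,
    its primitive part divides all of [P_k] in [R[x][y]].  Counting dimensions,
    this factor has degree [k - 3]; since four points impose independent
    conditions on cubics, exactly three nodes are off it. *)

(** * Bivariate polynomials and spaces of curves through nodes *)

Section Bivariate.
Variable F : fieldType.
Local Notation B := {poly {poly F}}.
Implicit Types (p q : B) (Z : seq (F * F)).

(* The outer variable is [y] and the inner one is [x]: [p`_i`_j] is the coefficient
   of [x^j y^i].  Degrees are bounded strictly, so that [m = 0] gives only [0]. *)
Definition deg_lt (m : nat) p : Prop :=
  forall i j, (m <= i + j)%N -> p`_i`_j = 0.

Definition ev2 p (z : F * F) : F := p.[z.2%:P].[z.1].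

Definition vanishing Z m p : Prop :=
  deg_lt m p /\ forall z, z \in Z -> ev2 p z = 0.

Lemma coefD2 p q i j : (p + q)`_i`_j = p`_i`_j + q`_i`_j.
Proof. by rewrite !coefD. Qed.

Lemma deg_ltD m p q : deg_lt m p -> deg_lt m q -> deg_lt m (p + q).
Proof. by move=> hp hq i j h; rewrite !coefD hp // hq // addr0. Qed.

Lemma deg_ltZ m (a : F) p : deg_lt m p -> deg_lt m (a%:P *: p).
Proof. by move=> hp i j h; rewrite coefZ coefCM hp // mulr0. Qed.

Lemma deg_ltW m m' p : (m <= m')%N -> deg_lt m p -> deg_lt m' p.
Proof. by move=> le hp i j h; apply: hp; apply: leq_trans h. Qed.

Lemma deg_lt_mulx m p : deg_lt m p -> deg_lt m.+1 ('X *: p).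
Proof. by move=> hp i [|j] h; rewrite coefZ coefXM //= hp //; lia. Qed.

Lemma deg_lt_muly m p : deg_lt m p -> deg_lt m.+1 (p * 'X).
Proof. by move=> hp [|i] j h; rewrite coefMX //= ?coef0 // hp //; lia. Qed.

Lemma deg_lt0 m : deg_lt m 0.
Proof. by move=> i j _; rewrite !coef0. Qed.

Lemma deg_lt0_eq0 p : deg_lt 0 p -> p = 0.
Proof. by move=> hp; apply/polyP=> i; apply/polyP=> j; rewrite hp // !coef0. Qed.

Lemma deg_ltM a b p q : deg_lt a.+1 p -> deg_lt b.+1 q -> deg_lt (a + b).+1 (p * q).
Proof.
move=> hp hq i j h; rewrite coefM coef_sum big1 // => -[u hu] _ /=.
rewrite coefM big1 // => -[v hv] _ /=.
have [h1|h1] := leqP a.+1 (u + v); first by rewrite hp // mul0r.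
by rewrite (hq (i - u)%N) ?mulr0 //; lia.
Qed.

Lemma ev2D p q z : ev2 (p + q) z = ev2 p z + ev2 q z.
Proof. by rewrite /ev2 !hornerD. Qed.

Lemma ev2M p q z : ev2 (p * q) z = ev2 p z * ev2 q z.
Proof. by rewrite /ev2 !hornerM. Qed.

Lemma ev2Z (a : {poly F}) p z : ev2 (a *: p) z = a.[z.1] * ev2 p z.
Proof. by rewrite /ev2 hornerZ hornerM. Qed.

Lemma vanishing_D Z m p q : vanishing Z m p -> vanishing Z m q -> vanishing Z m (p + q).
Proof.
move=> [hp vp] [hq vq]; split; first exact: deg_ltD.
by move=> z hz; rewrite ev2D vp // vq // addr0.
Qed.

Lemma vanishing_Z Z m (a : F) p : vanishing Z m p -> vanishing Z m (a%:P *: p).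
Proof.
move=> [hp vp]; split; first exact: deg_ltZ.
by move=> z hz; rewrite ev2Z vp // mulr0.
Qed.

Lemma vanishing_B Z m p q : vanishing Z m p -> vanishing Z m q -> vanishing Z m (p - q).
Proof.
by move=> hp hq; rewrite -scaleN1r -polyCN; apply/vanishing_D/vanishing_Z.
Qed.

Lemma vanishing_0 Z m : vanishing Z m 0.
Proof. by split; [exact: deg_lt0 | move=> z _; rewrite /ev2 !horner0]. Qed.

Lemma vanishing_W Z m m' p : (m <= m')%N -> vanishing Z m p -> vanishing Z m' p.
Proof. by move=> le [hp vp]; split=> //; apply: deg_ltW hp. Qed.

Lemma vanishing_mulx Z m p : vanishing Z m p -> vanishing Z m.+1 ('X *: p).
Proof.
move=> [hp vp]; split; first exact: deg_lt_mulx.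
by move=> z hz; rewrite ev2Z vp // mulr0.
Qed.

Lemma vanishing_muly Z m p : vanishing Z m p -> vanishing Z m.+1 (p * 'X).
Proof.
move=> [hp vp]; split; first exact: deg_lt_muly.
by move=> z hz; rewrite ev2M vp // mul0r.
Qed.

Lemma dim_full_rV m : \dim (fullv : {vspace 'rV[F]_m}) = m.
Proof. by rewrite dimvf dim_matrix; exact: mul1n. Qed.

Lemma dim_addv_line (E : vectType F) (U : {vspace E}) v : v \notin U -> \dim (U + <[v]>)%VS = (\dim U).+1.
Proof.
move=> vU; have := dimv_sum_cap U <[v]>%VS.
have -> : (U :&: <[v]>)%VS = 0%VS.
  apply/eqP; rewrite -subv0; apply/subvP=> u; rewrite memv_cap => /andP[uU /vlineP[a ea]].
  have [a0|a0] := eqVneq a 0; first by rewrite ea a0 scale0r mem0v.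
  by case/negP: vU; rewrite -[v](scalerK a0) -ea memvZ.
rewrite dimv0 dim_vline addn0.
have -> : v != 0 by apply: contraNneq vU => ->; exact: mem0v.
by move=> ->; rewrite addn1.
Qed.

Lemma dim_lt_notin (E : vectType F) (U U' : {vspace E}) v :
  (U <= U')%VS -> v \in U' -> v \notin U -> (\dim U < \dim U')%N.
Proof.
move=> le vU' vU; rewrite -(dim_addv_line vU); apply: dimvS.
by rewrite subv_add le -memvE.
Qed.

(** * Curve spaces as subspaces of matrices, and the growth of their dimensions *)

Section Coordinates.
Variable N : nat.
Local Notation E := 'M[F]_N.+1.
Implicit Types (A : E).

(** Matrices supply a finite-dimensional [vectType]. Coefficients with an index above [N] are
    dropped, so [dec (enc p) = p] is available under a degree bound ([encK]), while
    [enc (dec A) = A] always holds. *)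
Definition enc p : E := \matrix_(i, j) p`_i`_j.
Definition dec A : B := \poly_(i < N.+1) \poly_(j < N.+1) A (inord i) (inord j).

Lemma coef_dec A (i j : 'I_N.+1) : (dec A)`_i`_j = A i j.
Proof. by rewrite coef_poly ltn_ord coef_poly ltn_ord !inord_val. Qed.

Lemma dec_out A i j : (N < i)%N || (N < j)%N -> (dec A)`_i`_j = 0.
Proof.
rewrite coef_poly; case: ifP => [hi|]; last by rewrite coef0.
by rewrite coef_poly; case: ifP => // hj; lia.
Qed.

Lemma decK : cancel dec enc.
Proof. by move=> A; apply/matrixP=> i j; rewrite mxE coef_dec. Qed.

Lemma encK p : deg_lt N.+1 p -> dec (enc p) = p.
Proof.
move=> hp; apply/polyP=> i; apply/polyP=> j.
have [hi|hi] := ltnP i N.+1; last by rewrite dec_out ?hi // hp //; lia.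
have [hj|hj] := ltnP j N.+1; last by rewrite dec_out ?hj ?orbT // hp //; lia.
by rewrite (coef_dec _ (Ordinal hi) (Ordinal hj)) mxE.
Qed.

Lemma encD p q : enc (p + q) = enc p + enc q.
Proof. by apply/matrixP=> i j; rewrite !mxE !coefD. Qed.

Lemma encZ (a : F) p : enc (a%:P *: p) = a *: enc p.
Proof. by apply/matrixP=> i j; rewrite !mxE coefZ coefCM. Qed.

Lemma decP A a A' : dec (a *: A + A') = a%:P *: dec A + dec A'.
Proof.
apply/polyP=> i; apply/polyP=> j; rewrite coefD coefZ coefD coefCM.
have [hi|hi] := ltnP i N.+1; last by rewrite !dec_out ?hi // mulr0 addr0.
have [hj|hj] := ltnP j N.+1; last by rewrite !dec_out ?hj ?orbT // mulr0 addr0.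
by rewrite !(coef_dec _ (Ordinal hi) (Ordinal hj)) !mxE.
Qed.

Lemma decD A A' : dec (A + A') = dec A + dec A'.
Proof. by have := decP A 1 A'; rewrite polyC1 !scale1r. Qed.

Lemma dec0 : dec 0 = 0.
Proof. by apply: (addrI (dec 0)); rewrite -decD !addr0. Qed.

Lemma decZ a A : dec (a *: A) = a%:P *: dec A.
Proof. by rewrite -[a *: A]addr0 decP dec0 addr0. Qed.

Lemma dec_sum (I : Type) (r : seq I) (P : pred I) (f : I -> E) :
  dec (\sum_(i <- r | P i) f i) = \sum_(i <- r | P i) dec (f i).
Proof. exact: (big_morph dec decD dec0). Qed.

Lemma dec_inj : injective dec.
Proof. exact: can_inj decK. Qed.

(** Prescribed zero coefficients are imposed through the kernel of a linear map, so that they cut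
    out a subspace. *)
Definition mask (P : rel nat) A : E :=
  \matrix_(i, j) if P i j then A i j else 0.

Lemma mask_linear P : linear (mask P).
Proof.
by move=> a A A'; apply/matrixP=> i j; rewrite !mxE; case: ifP => // _;
  rewrite mulr0 addr0.
Qed.
HB.instance Definition _ P :=
  GRing.isLinear.Build F E E _ (mask P) (mask_linear P).

Definition zeroing (P : rel nat) : {vspace E} := lker (linfun (mask P)).

Lemma zeroingP (P : rel nat) A :
  reflect (forall i j, P i j -> (dec A)`_i`_j = 0) (A \in zeroing P).
Proof.
rewrite memv_ker lfunE /=; apply: (iffP eqP) => [h i j Pij|h].
  have [hi|hi] := ltnP i N.+1; last by rewrite dec_out ?hi.
  have [hj|hj] := ltnP j N.+1; last by rewrite dec_out ?hj ?orbT.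
  rewrite (coef_dec _ (Ordinal hi) (Ordinal hj)).
  by move/matrixP/(_ (Ordinal hi) (Ordinal hj)): h; rewrite !mxE /= Pij.
apply/matrixP=> i j; rewrite !mxE; case: ifP => // Pij.
by rewrite -coef_dec h.
Qed.

Definition evmx Z A : 'rV[F]_(size Z) := \row_i ev2 (dec A) (nth (0, 0) Z i).

Lemma evmx_linear Z : linear (evmx Z).
Proof.
move=> a A A'; apply/rowP=> i; rewrite !mxE decP ev2D ev2Z.
by rewrite hornerC.
Qed.
HB.instance Definition _ Z :=
  GRing.isLinear.Build F E 'rV[F]_(size Z) _ (evmx Z) (evmx_linear Z).

Lemma evmxP Z A :
  reflect (forall z, z \in Z -> ev2 (dec A) z = 0) (A \in lker (linfun (evmx Z))).
Proof.
rewrite memv_ker lfunE /=; apply: (iffP eqP) => [h z zZ|h].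
  move/rowP: h; rewrite -index_mem in zZ; move/(_ (Ordinal zZ)).
  by rewrite !mxE /= nth_index // -index_mem.
by apply/rowP=> i; rewrite !mxE h // mem_nth.
Qed.

Definition deg_lt_space m : {vspace E} := zeroing (fun i j => m <= i + j)%N.
(** The bound is strict: for positive [m] this is the space [P_(m-1)]. *)
Definition vanishing_space Z m : {vspace E} :=
  (deg_lt_space m :&: lker (linfun (evmx Z)))%VS.

Lemma deg_lt_spaceP m A : reflect (deg_lt m (dec A)) (A \in deg_lt_space m).
Proof. exact: zeroingP. Qed.

Lemma vanishing_spaceP Z m A : reflect (vanishing Z m (dec A)) (A \in vanishing_space Z m).
Proof.
rewrite memv_cap; apply: (iffP andP) => -[].
  by move=> /deg_lt_spaceP h1 /evmxP.
by move=> /deg_lt_spaceP h1 /evmxP.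
Qed.

Lemma vanishing_space_enc Z m p : (m <= N.+1)%N ->
  vanishing Z m p -> enc p \in vanishing_space Z m.
Proof. by move=> le hp; apply/vanishing_spaceP; rewrite encK //; apply: deg_ltW hp.1. Qed.

Lemma vanishing_space_sub Z m m' : (m <= m')%N ->
  (vanishing_space Z m <= vanishing_space Z m')%VS.
Proof.
move=> le; apply/subvP=> A /vanishing_spaceP h; apply/vanishing_spaceP.
exact: vanishing_W h.
Qed.

Lemma vanishing_space_0 Z : vanishing_space Z 0 = 0%VS.
Proof.
apply/eqP; rewrite -subv0; apply/subvP=> A /vanishing_spaceP[/deg_lt0_eq0 h _].
by rewrite memv0; apply/eqP/dec_inj; rewrite dec0.
Qed.

(** Re-encoding may truncate; multiplication by [x] is faithful for degrees below [N], see
    [dec_mulx]. *)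
Definition mulx A : E := enc ('X *: dec A).
Lemma mulx_linear : linear mulx.
Proof.
move=> a A A'; rewrite /mulx decP scalerDr encD; congr (_ + _).
by rewrite scalerA mulrC -scalerA encZ.
Qed.
HB.instance Definition _ := GRing.isLinear.Build F E E _ mulx mulx_linear.

Lemma deg_lt_mulxK m p : deg_lt m.+1 ('X *: p) -> deg_lt m p.
Proof.
by move=> h i j le; have := h i j.+1; rewrite coefZ coefXM /=; apply; lia.
Qed.

Lemma dec_mulx A m : deg_lt m (dec A) -> (m <= N)%N -> dec (mulx A) = 'X *: dec A.
Proof. by move=> h le; rewrite encK //; apply: (@deg_ltW m.+1) => //; apply: deg_lt_mulx. Qed.

(** This is [P + x P] for [P = vanishing_space Z m]. *)
Definition shift_space Z m : {vspace E} :=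
  (vanishing_space Z m + (linfun mulx @: vanishing_space Z m))%VS.

Lemma shift_spaceP Z m A : (m <= N)%N ->
  reflect (exists a b, [/\ vanishing Z m a, vanishing Z m b & dec A = a + 'X *: b])
          (A \in shift_space Z m).
Proof.
move=> le; apply: (iffP memv_addP).
  move=> [a /vanishing_spaceP ha [_ /memv_imgP[b /vanishing_spaceP hb ->] ->]].
  by exists (dec a), (dec b); split=> //; rewrite decD lfunE /= (dec_mulx hb.1 le).
move=> [a [b [ha hb e]]].
exists (enc a); first by apply: vanishing_space_enc => //; lia.
exists (linfun mulx (enc b)).
  by apply: memv_img; apply: vanishing_space_enc => //; lia.
have Eb : dec (enc b) = b by apply: encK; apply: (deg_ltW _ hb.1); lia.
have Ea : dec (enc a) = a by apply: encK; apply: (deg_ltW _ ha.1); lia.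
have hb1 : deg_lt m (dec (enc b)) by rewrite Eb; exact: hb.1.
by apply: dec_inj; rewrite decD Ea lfunE /= (dec_mulx hb1) ?Eb.
Qed.

Lemma shift_space_sub Z m : (m <= N)%N -> (shift_space Z m <= vanishing_space Z m.+1)%VS.
Proof.
move=> le; apply/subvP=> A /(shift_spaceP _ _ le)[a [b [ha hb e]]]; apply/vanishing_spaceP.
by rewrite e; apply: vanishing_D; [apply: vanishing_W ha | apply: vanishing_mulx].
Qed.

(** Multiplication by [x] is injective on [U], and an element [x b] of [U] has [b] of degree one
    less. Hence the intersection of [U] and [x U] has at most the dimension of
    [vanishing_space Z m]. *)
Lemma dim_shift_space Z m : (m < N)%N ->
  (2 * \dim (vanishing_space Z m.+1) <=
     \dim (shift_space Z m.+1) + \dim (vanishing_space Z m))%N.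
Proof.
move=> le; have le' : (m <= N)%N by lia.
set U := vanishing_space Z m.+1; set xU := (linfun mulx @: U)%VS.
have dxU : \dim xU = \dim U.
  apply: limg_dim_eq; apply/eqP; rewrite -subv0; apply/subvP=> A.
  rewrite memv_cap => /andP[/vanishing_spaceP hA]; rewrite memv_ker lfunE /= => /eqP h0.
  have := dec_mulx hA.1 le; rewrite h0 dec0 => /esym/eqP.
  rewrite scale_poly_eq0 polyX_eq0 /= => /eqP h.
  by rewrite memv0; apply/eqP/dec_inj; rewrite dec0.
have cap : (U :&: xU <= linfun mulx @: vanishing_space Z m)%VS.
  apply/subvP=> A; rewrite memv_cap => /andP[/vanishing_spaceP hA /memv_imgP[b /vanishing_spaceP hb e]].
  rewrite e; apply: memv_img; apply/vanishing_spaceP; split; last exact: hb.2.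
  by apply: deg_lt_mulxK; rewrite -(dec_mulx hb.1 le) -[mulx b](lfunE mulx) -e; exact: hA.1.
have e1 := dimvS cap; have e2 := limg_ker_dim (linfun mulx) (vanishing_space Z m).
have e3 : (\dim (shift_space Z m.+1) + \dim (U :&: xU) = \dim U + \dim xU)%N
  by exact: dimv_sum_cap.
rewrite dxU in e3.
have e4 : (\dim (U :&: xU) <= \dim (vanishing_space Z m))%N.
  by apply: leq_trans e1 _; rewrite -e2 leq_addl.
by rewrite mul2n -addnn -e3 leq_add2l.
Qed.

(** Since [a] has degree at most [m], the terms of degree [m + 1] come from [x b] alone, which has
    none in [y^(m+1)]. *)
Lemma top_coef_shift Z m a b i : vanishing Z m.+1 a -> vanishing Z m.+1 b ->
  (a + 'X *: b)`_i`_(m.+1 - i) = if (i <= m)%N then b`_i`_(m - i) else 0.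
Proof.
move=> ha hb; rewrite !coefD coefZ coefXM ha.1; last lia.
case: leqP => h; last first.
  by have -> : (m.+1 - i = 0)%N; [lia | rewrite eqxx addr0].
by rewrite subSn //= add0r.
Qed.

(* If [i] is the largest [y]-degree of a leading form and [f] attains it, then
   [y f] is not in [P + x P]. *)
Lemma dim_growth Z m : (m < N)%N ->
  (\dim (vanishing_space Z m) < \dim (vanishing_space Z m.+1))%N ->
  (2 * \dim (vanishing_space Z m.+1) <
     \dim (vanishing_space Z m.+2) + \dim (vanishing_space Z m))%N.
Proof.
move=> le lt.
have [A hA [i0 nzA]] : exists2 A, A \in vanishing_space Z m.+1 &
    exists i, (i <= m)%N && ((dec A)`_i`_(m - i) != 0).
  have /subvPn[A hA nA] : ~~ (vanishing_space Z m.+1 <= vanishing_space Z m)%VS.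
    by apply: contraL lt => /dimvS; rewrite -leqNgt.
  exists A => //.
  have /vanishing_spaceP[h1 h2] := hA.
  have [/existsP[i hi]|/existsPn h] :=
    boolP [exists i : 'I_m.+1, (dec A)`_i`_(m - i) != 0].
    by exists i; rewrite hi andbT -ltnS ltn_ord.
  case/negP: nA; apply/vanishing_spaceP; split=> // i j leij.
  have [h3|h3] := ltnP m (i + j); first by rewrite h1.
  have e : (i + j = m)%N by lia.
  have hi : (i < m.+1)%N by lia.
  have := h (Ordinal hi); rewrite negbK /= => /eqP.
  by have -> : (m - i = j)%N by lia.
(* [Q i] says that [y^i] occurs in a leading form of degree [m]. Stated on a basis it is decidable,
   so a maximal [i] can be taken. *)
pose Q i := [exists j : 'I_(\dim (vanishing_space Z m.+1)),
  (i <= m)%N && ((dec (vbasis (vanishing_space Z m.+1))`_j)`_i`_(m - i) != 0)].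
have QP i f : f \in vanishing_space Z m.+1 -> (i <= m)%N -> (dec f)`_i`_(m - i) != 0 -> Q i.
  move=> hf lei; apply: contra_neqT => /existsPn h.
  rewrite (coord_vbasis hf) dec_sum !coef_sum big1 // => j _.
  have := h j; rewrite lei negbK => /eqP e.
  by rewrite decZ coefZ coefCM e mulr0.
have exQ : exists i, Q i by case/andP: nzA => a b; exists i0; apply: (QP _ A).
have bQ i : Q i -> (i <= m)%N by case/existsP => j /andP[].
case: (ex_maxnP exQ bQ) => i /existsP[j /andP[lei nz]] maxi.
set f := (vbasis (vanishing_space Z m.+1))`_j in nz.
have hf : f \in vanishing_space Z m.+1 by apply: vbasis_mem; rewrite mem_nth // size_tuple.
have /vanishing_spaceP hVf := hf.
have hyf : vanishing Z m.+2 (dec f * 'X) by apply: vanishing_muly.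
have nW : enc (dec f * 'X) \notin shift_space Z m.+1.
  apply/negP => /(shift_spaceP _ _ le)[a [b [ha hb]]].
  rewrite encK; last by apply: (deg_ltW _ hyf.1); lia.
  move/(congr1 (fun p => p`_i.+1`_(m.+1 - i.+1))).
  rewrite (top_coef_shift _ ha hb) coefMX /= subSS => e.
  move: nz; rewrite e; case: ifP => [h|]; last by rewrite eqxx.
  (* The leading form of [b] would contain [y^(i+1)], against the maximality of [i]. *)
  move=> nz; have /maxi : Q i.+1; last by rewrite ltnn.
  have Eb : dec (enc b) = b by apply: encK; apply: (deg_ltW _ hb.1); lia.
  apply: (QP _ (enc b)) => //; last by rewrite Eb.
  by apply: vanishing_space_enc => //; lia.
have := dim_shift_space Z le.
have := dim_lt_notin (shift_space_sub Z le) (vanishing_space_enc _ hyf) nW; lia.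
Qed.


(** * Leading forms, rank-nullity counts, and the structure in the extremal case *)

Definition topmx m A : 'rV[F]_m.+1 := \row_i (dec A)`_i`_(m - i).

Lemma topmx_linear m : linear (topmx m).
Proof.
by move=> a A A'; apply/rowP=> i; rewrite !mxE decP coefD coefZ coefD coefCM.
Qed.
HB.instance Definition _ m :=
  GRing.isLinear.Build F E 'rV[F]_m.+1 _ (topmx m) (topmx_linear m).

Lemma deg_lt_top m p : deg_lt m.+1 p ->
  (forall i, (i <= m)%N -> p`_i`_(m - i) = 0) -> deg_lt m p.
Proof.
move=> h h0 i j; rewrite leq_eqVlt => /predU1P[e|]; last exact: h.
by have := h0 i; rewrite e addKn; apply; rewrite leq_addr.
Qed.

(** Rank-nullity for [topmx m]: its kernel consists of the lower degrees, and it is onto because any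
    row is the coefficient list of a form. *)
Lemma dim_deg_lt_spaceS m : (m <= N)%N ->
  \dim (deg_lt_space m.+1) = (\dim (deg_lt_space m) + m.+1)%N.
Proof.
move=> le; rewrite -(limg_ker_dim (linfun (topmx m)) (deg_lt_space m.+1)).
congr (_ + _)%N.
  congr (\dim _); apply/vspaceP=> A; rewrite memv_cap memv_ker lfunE /=.
  apply/andP/deg_lt_spaceP => [[/deg_lt_spaceP h /eqP/rowP h0]|h].
    apply: deg_lt_top h _ => i lei.
    by have := h0 (Ordinal (lei : (i < m.+1)%N)); rewrite !mxE.
  split; first by apply/deg_lt_spaceP; apply: deg_ltW h.
  by apply/eqP/rowP=> i; rewrite !mxE h //; have := ltn_ord i; lia.
have -> : (linfun (topmx m) @: deg_lt_space m.+1)%VS = fullv.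
  apply/vspaceP=> r; rewrite memvf.
  pose p : B := \poly_(i < m.+1) (r 0 (inord i) *: 'X^(m - i)).
  have hp : deg_lt m.+1 p.
    move=> i j h; rewrite coef_poly; case: ifP => h1; last by rewrite coef0.
    by rewrite coefZ coefXn; case: eqP => [|_]; rewrite ?mulr0 //; lia.
  have Ep : dec (enc p) = p by apply: encK; apply: deg_ltW hp.
  apply/memv_imgP; exists (enc p); first by apply/deg_lt_spaceP; rewrite Ep.
  apply/rowP=> i; rewrite lfunE /= !mxE Ep coef_poly ltn_ord inord_val.
  by rewrite coefZ coefXn eqxx mulr1.
exact: dim_full_rV.
Qed.

Lemma dim_deg_lt_space m : (m <= N.+1)%N -> \dim (deg_lt_space m) = 'C(m.+1, 2).
Proof.
elim: m => [_|m IH le]; last first.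
  by rewrite (dim_deg_lt_spaceS (le : (m <= N)%N)) (IH (ltnW le)) [RHS]binS bin1.
rewrite bin_small //; apply/eqP; rewrite dimv_eq0 -subv0; apply/subvP=> A /deg_lt_spaceP/deg_lt0_eq0 h.
by rewrite memv0; apply/eqP/dec_inj; rewrite dec0.
Qed.

Lemma dim_vanishing_space_ge Z m : (m <= N.+1)%N ->
  ('C(m.+1, 2) <= \dim (vanishing_space Z m) + size Z)%N.
Proof.
move=> le; rewrite -(dim_deg_lt_space le) -(limg_ker_dim (linfun (evmx Z)) (deg_lt_space m)) leq_add2l.
by rewrite -[X in (_ <= X)%N]dim_full_rV dimvS // subvf.
Qed.

(** Fundamental polynomials are sent to the unit vectors, so evaluation at the nodes is onto and
    rank-nullity is exact. *)
Lemma dim_vanishing_space_indep Z m : (m <= N.+1)%N -> uniq Z ->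
  (forall z, z \in Z -> exists p, [/\ deg_lt m p, ev2 p z = 1 &
     forall z', z' \in Z -> z' != z -> ev2 p z' = 0]) ->
  (\dim (vanishing_space Z m) + size Z = 'C(m.+1, 2))%N.
Proof.
move=> le uZ ind; rewrite -(dim_deg_lt_space le) -(limg_ker_dim (linfun (evmx Z)) (deg_lt_space m)).
congr (_ + _)%N.
have -> : (linfun (evmx Z) @: deg_lt_space m)%VS = fullv; last by rewrite dim_full_rV.
apply/vspaceP=> r; rewrite memvf.
rewrite [r]row_sum_delta; apply: memv_suml => i _; apply: memvZ.
have [p [hp hz hz']] := ind _ (mem_nth (0, 0) (ltn_ord i)).
have Ep : dec (enc p) = p by apply: encK; apply: deg_ltW hp.
apply/memv_imgP; exists (enc p); first by apply/deg_lt_spaceP; rewrite Ep.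
apply/rowP=> j; rewrite lfunE /= !mxE Ep eqxx /=.
have [->|ne] := eqVneq j i; first by rewrite hz.
by rewrite hz' ?mem_nth // nth_uniq.
Qed.

(** No element of [P_k + x P_k] contains [y^(k+1)], but [y w] does. The dimension hypothesis leaves
    room for just this one extra direction, so [P_(k+1) = P_k + x P_k + <y w>], and the coefficient
    of [y^(k+1)] detects the component along [y w]. *)
Lemma vanishing_split Z k w : (k < N)%N ->
  (\dim (vanishing_space Z k.+2) + \dim (vanishing_space Z k) <=
     (2 * \dim (vanishing_space Z k.+1)).+1)%N ->
  vanishing Z k.+1 w -> w`_k`_0 != 0 ->
  forall p, vanishing Z k.+2 p -> p`_k.+1`_0 = 0 ->
  exists a b, [/\ vanishing Z k.+1 a, vanishing Z k.+1 b & p = a + 'X *: b].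
Proof.
move=> le dle hw nzw p hp p0.
have hyw : vanishing Z k.+2 (w * 'X) by apply: vanishing_muly.
have Eyw : dec (enc (w * 'X)) = w * 'X by apply: encK; apply: deg_ltW hyw.1.
have topW a b : vanishing Z k.+1 a -> vanishing Z k.+1 b -> (a + 'X *: b)`_k.+1`_0 = 0.
  by move=> ha hb; have := top_coef_shift k.+1 ha hb; rewrite subnn ltnn.
have nW : enc (w * 'X) \notin shift_space Z k.+1.
  apply/negP => /(shift_spaceP _ _ le)[a [b [ha hb]]]; rewrite Eyw.
  move/(congr1 (fun p => p`_k.+1`_0)); rewrite topW // coefMX /= => e.
  by rewrite e eqxx in nzw.
have sub : (shift_space Z k.+1 + <[enc (w * 'X)]> <= vanishing_space Z k.+2)%VS.
  by rewrite subv_add shift_space_sub // -memvE vanishing_space_enc.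
have eqW : (shift_space Z k.+1 + <[enc (w * 'X)]>)%VS = vanishing_space Z k.+2.
  apply/eqP; rewrite eqEdim sub /= (dim_addv_line nW).
  rewrite -(leq_add2r (\dim (vanishing_space Z k))); apply: leq_trans dle _.
  by rewrite addSn ltnS; exact: dim_shift_space.
have := vanishing_space_enc (le : (k.+2 <= N.+1)%N) hp; rewrite -eqW.
case/memv_addP=> u /(shift_spaceP _ _ le)[a [b [ha hb e]]] [_ /vlineP[c ->] ep].
exists a, b; split=> //.
have {}ep : p = a + 'X *: b + c%:P *: (w * 'X).
  rewrite -e -Eyw -decZ -decD -ep encK //; exact: deg_ltW hp.1.
move: p0; rewrite ep coefD2 topW // coefZ coefCM coefMX /= add0r.
move/eqP; rewrite mulf_eq0 (negPf nzw) orbF => /eqP ->.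
by rewrite scale0r addr0.
Qed.

(** A leading form of [y]-degree [i < k] yields one of [y]-degree [i + 1], by splitting [y p]. Thus
    all the [y]-degrees from [i] to [k] occur, which gives [k + 1 - i] independent leading forms. *)
Lemma top_index_ge Z k : (k < N)%N ->
  (forall p, vanishing Z k.+2 p -> p`_k.+1`_0 = 0 ->
     exists a b, [/\ vanishing Z k.+1 a, vanishing Z k.+1 b & p = a + 'X *: b]) ->
  forall i p, (i <= k)%N -> vanishing Z k.+1 p -> p`_i`_(k - i) != 0 ->
  (forall i', (i < i' <= k)%N -> p`_i'`_(k - i') = 0) ->
  (\dim (vanishing_space Z k) + (k.+1 - i) <= \dim (vanishing_space Z k.+1))%N.
Proof.
move=> le split.
(* [Q i] collects the elements whose leading form has [y]-degree below [i]; the inclusions from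
   [Q i] up to the whole space are shown to be strict. *)
pose Q i := (vanishing_space Z k.+1 :&: zeroing (fun a b => (i <= a) && (a + b == k)))%N%VS.
have QS i : (Q i <= vanishing_space Z k.+1)%VS by rewrite capvSl.
have SQ i : (vanishing_space Z k <= Q i)%VS.
  apply/subvP=> A hA; rewrite memv_cap (subvP (vanishing_space_sub Z (leqnSn k))) //=.
  by apply/zeroingP=> a b /andP[_ /eqP e]; case/vanishing_spaceP: hA => h _; rewrite h ?e.
suff main i p : (i <= k)%N -> vanishing Z k.+1 p -> p`_i`_(k - i) != 0 ->
  (forall i', (i < i' <= k)%N -> p`_i'`_(k - i') = 0) ->
  (\dim (Q i) + (k.+1 - i) <= \dim (vanishing_space Z k.+1))%N.
  move=> i p h1 h2 h3 h4; apply: leq_trans (main _ _ h1 h2 h3 h4).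
  by rewrite leq_add2r dimvS.
move=> lei; have [d] := ubnP (k - i); elim: d i p lei => // d IH i p lei ltd hp nz zr.
have [e|ltik] := eqVneq i k.
  rewrite e subSnn addn1 in nz *; rewrite subnn in nz.
  apply: (@dim_lt_notin _ _ _ (enc p)) => //; first by apply: vanishing_space_enc => //; lia.
  have Ep : dec (enc p) = p by apply: encK; apply: (deg_ltW _ hp.1); lia.
  rewrite memv_cap negb_and; apply/orP; right; apply/negP => /zeroingP/(_ k 0).
  rewrite Ep addn0 leqnn eqxx /= => /(_ isT) h.
  by rewrite h eqxx in nz.
have Ep : dec (enc p) = p by apply: encK; apply: (deg_ltW _ hp.1); lia.
have ltQ : (\dim (Q i) < \dim (Q i.+1))%N.
  apply: (@dim_lt_notin _ _ _ (enc p)).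
  - apply/subvP=> A; rewrite !memv_cap => /andP[-> /zeroingP h].
    by apply/zeroingP=> a b /andP[h1 h2]; apply: h; rewrite h2 andbT; lia.
  - rewrite memv_cap vanishing_space_enc //=; last lia.
    apply/zeroingP=> a b /andP[h1 /eqP h2]; rewrite Ep.
    by have -> : b = (k - a)%N; [lia | apply: zr; lia].
  - rewrite memv_cap negb_and; apply/orP; right; apply/negP => /zeroingP/(_ i (k - i)%N).
    by rewrite Ep leqnn subnKC // eqxx => /(_ isT) h; rewrite h eqxx in nz.
have hyp : vanishing Z k.+2 (p * 'X) by apply: vanishing_muly.
have [|a [b [ha hb eab]]] := split _ hyp.
  by rewrite coefMX /=; have := zr k; rewrite subnn; apply; lia.
(* In [y p = a + x b] the leading form of [b] is that of [p] times [y / x]. *)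
have shift i' : (i' < k)%N -> b`_i'.+1`_(k - i'.+1) = p`_i'`_(k - i').
  move=> lt; have := top_coef_shift i'.+1 ha hb; rewrite -eab lt coefMX /= => <-.
  by rewrite subSS.
have lt : (i < k)%N by lia.
have := IH i.+1 b lt; rewrite shift // => /(_ _ hb nz) IHb.
have {}IHb : (\dim (Q i.+1) + (k.+1 - i.+1) <= \dim (vanishing_space Z k.+1))%N.
  apply: IHb; first lia.
  move=> [|i'] // /andP[h1 h2]; rewrite shift //; apply: zr; lia.
apply: leq_trans IHb; rewrite subSS subSn // addnS -addSn leq_add2r //.
Qed.
End Coordinates.
End Bivariate.

(** * Gauss's lemma and the common factor *)

Section Gauss.
Variable F : fieldType.
Implicit Types (a c d : {poly F}) (p q G : {poly {poly F}}).

Definition primitive G := forall d, (forall i, d %| G`_i) -> (size d <= 1)%N.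

(** Descent on the size reaches an [a] without smaller nonconstant divisors. If it is not coprime to
    [u], then [gcdp a u] has the size of [a], so [a] divides [u]; otherwise it divides [v]. *)
Lemma irreducible_divisor a : (1 < size a)%N ->
  exists2 d : {poly F}, (1 < size d)%N & (d %| a) /\
    forall u v, d %| u * v -> (d %| u) || (d %| v).
Proof.
have [m] := ubnP (size a); elim: m a => // m IH a lem lta.
have a0 : a != 0 by rewrite -size_poly_gt0; lia.
have [[b [h1 h2 h3]]|irr] := boolp.EM (exists b : {poly F}, [/\ (1 < size b)%N, (size b < size a)%N & b %| a]).
  have [d hd [dvd pr]] : exists2 d : {poly F}, (1 < size d)%N & (d %| b) /\
      forall u v, d %| u * v -> (d %| u) || (d %| v) by apply: IH => //; lia.
  by exists d => //; split=> //; apply: dvdp_trans h3.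
exists a => //; split=> // u v; have [c1 h|nc] := boolP (coprimep a u).
  by rewrite (Gauss_dvdpr _ c1) in h; rewrite h orbT.
move=> _; apply/orP; left.
have g0 : gcdp a u != 0 by rewrite gcdp_eq0 negb_and a0.
have gs : (1 < size (gcdp a u))%N.
  by rewrite ltn_neqAle eq_sym -coprimep_def nc size_poly_gt0.
have le : (size (gcdp a u) <= size a)%N by rewrite dvdp_leq // dvdp_gcdl.
have e : size (gcdp a u) = size a.
  apply/eqP; rewrite eqn_leq le leqNgt; apply/negP => lt; apply: irr.
  by exists (gcdp a u); split=> //; exact: dvdp_gcdl.
have := dvdp_size_eqp (dvdp_gcdl a u); rewrite e eqxx => /esym/eqp_dvdl <-.
exact: dvdp_gcdr.
Qed.

(** Gauss's argument: let [m] be the least index with [p_m] not divisible by [d]. In the coefficient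
    [m + j] of [p * q] every term but [p_m q_j] is divisible by [d], by the choice of [m] or by
    induction on [j]. *)
Lemma prime_dvd_coefM d p q :
  (forall u v, d %| u * v -> (d %| u) || (d %| v)) ->
  (forall i, d %| (p * q)`_i) -> ~ (forall i, d %| p`_i) -> forall i, d %| q`_i.
Proof.
move=> pr dpq np.
have ex : exists i, ~~ (d %| p`_i).
  apply: boolp.contrapT => h; apply: np => i; apply: boolp.contrapT => /negP hi.
  by apply: h; exists i.
case: (ex_minnP ex) => m ndm minm j.
have [t] := ubnP j; elim: t j => // t IH j ltj.
have := dpq (m + j)%N; rewrite coefM (bigD1 (inord m)) //= inordK; last by lia.
rewrite addKn dvdp_addl.
  by case/pr/orP => // h; rewrite h in ndm.
apply: (big_ind (fun u => d %| u)); [exact: dvdp0| exact: dvdp_add|].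
move=> i /eqP ne; have [lt|ge] := ltnP i m.
  by apply: dvdp_mulr; apply: contraT => /minm; lia.
apply: dvdp_mull; apply: IH.
have : (i : nat) <> m by move=> e; apply: ne; apply/val_inj; rewrite /= inordK ?ltnS ?leq_addr //.
by have := ltn_ord i; lia.
Qed.

Lemma dvdp_coefs d p : d != 0 -> (forall i, d %| p`_i) -> exists q, p = d *: q.
Proof.
move=> d0 h; exists (\poly_(i < size p) (p`_i %/ d)).
apply/polyP=> i; rewrite coefZ coef_poly; case: ltnP => hi.
  by rewrite mulrC divpK.
by rewrite nth_default // mulr0.
Qed.

(** Extracting a nonconstant common divisor lowers the degree of the leading coefficient, so the
    process stops. *)
Lemma exists_primitive p : p != 0 -> exists a q, [/\ a != 0, primitive q & p = a *: q].
Proof.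
move=> p0; have [m] := ubnP (size (lead_coef p)); elim: m p p0 => // m IH p p0 lt.
have [pp|/boolp.existsNP[d /boolp.not_implyP[dvd /negP]]] := boolp.EM (primitive p).
  by exists 1, p; rewrite oner_neq0 scale1r.
rewrite -ltnNge => sd.
have d0 : d != 0 by rewrite -size_poly_gt0; lia.
have [q e] := dvdp_coefs d0 dvd.
have q0 : q != 0 by apply: contraNneq p0 => q0; rewrite e q0 scaler0.
have [|a [r [a0 pr er]]] := IH q q0.
  move: lt; rewrite e lead_coefZ size_mul ?lead_coef_eq0 //.
  by case: (size d) sd => // -[] // t _; rewrite !addSn /= !ltnS => h; apply: leq_trans h; exact: leq_addl.
exists (d * a), r; split=> //; first by rewrite mulf_neq0.
by rewrite -scalerA -er.
Qed.

(** Each prime factor of [a] divides all coefficients of [q * G] but not all those of [G], hence all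
    those of [q], and can be cancelled until [a] is constant. *)
Lemma primitive_dvd a p q G : a != 0 -> primitive G -> a *: p = q * G ->
  exists r, p = r * G.
Proof.
move=> + prG; have [m] := ubnP (size a); elim: m a q => // m IH a q lt a0 e.
have [s1|] := leqP (size a) 1.
  have [c c0 ea] : exists2 c, c != 0 & a = c%:P.
    exists a`_0; last exact: size1_polyC.
    by apply: contraNneq a0 => h; rewrite (size1_polyC s1) h.
  exists (c^-1%:P *: q); rewrite -scalerAl -e ea scalerA -polyCM mulVf //.
  by rewrite scale1r.
case/irreducible_divisor=> d sd [da pr].
have d0 : d != 0 by rewrite -size_poly_gt0; lia.
have dG : ~ (forall i, d %| G`_i) by move=> /prG; lia.
have dq : forall i, d %| q`_i.
  apply: (prime_dvd_coefM pr _ dG) => i.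
  by rewrite mulrC -e coefZ dvdp_mulr.
have [q' eq'] := dvdp_coefs d0 dq.
have ea : a = d * (a %/ d) by rewrite mulrC divpK.
have a'0 : a %/ d != 0 by apply: contraNneq a0 => h; rewrite ea h mulr0.
apply: (IH (a %/ d) q') => //.
  have sa : (0 < size a)%N by rewrite size_poly_gt0.
  rewrite size_divp //; move: (size a) (size d) lt sa sd => x y; lia.
have dP0 : d%:P != 0 :> {poly {poly F}} by rewrite polyC_eq0.
apply: (mulfI dP0).
by rewrite !mul_polyC scalerA -ea e eq' scalerAl.
Qed.
End Gauss.

(** * The module over [F[x]] spanned by the curves, and its generator *)

Section CommonFactor.
Variable F : fieldType.
Variables (Z : seq (F * F)) (k e : nat).
Local Notation B := {poly {poly F}}.

(* The [F[x]]-module spanned by the curves, built by Horner's scheme in [x]. *)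
Inductive xspan : B -> Prop :=
| xspan_base p : vanishing Z k.+1 p -> xspan p
| xspan_step p q : vanishing Z k.+1 p -> xspan q -> xspan (p + 'X *: q).

Lemma xspanD p q : xspan p -> xspan q -> xspan (p + q).
Proof.
move=> hp; elim: hp q => [{}p hp|{}p r hp hr IH] q.
  case=> [{}q hq|{}q s hq hs]; first exact/xspan_base/vanishing_D.
  by rewrite addrA; apply: xspan_step => //; apply: vanishing_D.
case=> [{}q hq|{}q s hq hs].
  by rewrite addrAC; apply: xspan_step => //; apply: vanishing_D.
by rewrite addrACA -scalerDr; apply: xspan_step; [exact: vanishing_D | exact: IH].
Qed.

Lemma xspanX p : xspan p -> xspan ('X *: p).
Proof. by rewrite -[_ *: p]add0r => hp; apply: xspan_step => //; exact: vanishing_0. Qed.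

Lemma xspanC (c : F) p : xspan p -> xspan (c%:P *: p).
Proof.
elim=> [{}p hp|{}p q hp hq IH]; first exact/xspan_base/vanishing_Z.
rewrite scalerDr scalerA mulrC -scalerA; apply: xspan_step => //; exact: vanishing_Z.
Qed.

Lemma xspanZ (a : {poly F}) p : xspan p -> xspan (a *: p).
Proof.
move=> hp; elim/poly_ind: a => [|a c IH].
  by rewrite scale0r; apply/xspan_base/vanishing_0.
rewrite scalerDl mulrC -scalerA; apply: xspanD; [exact: xspanX | exact: xspanC].
Qed.

Lemma xspanB p q : xspan p -> xspan q -> xspan (p - q).
Proof. by move=> hp hq; rewrite -scaleN1r; apply/xspanD/xspanZ. Qed.

Lemma xspan_size p : xspan p -> (size p <= k.+1)%N.
Proof.
have base q : vanishing Z k.+1 q -> (size q <= k.+1)%N.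
  move=> [h _]; apply/leq_sizeP => i le; apply/polyP=> j.
  by rewrite h ?coef0 //; lia.
elim=> [{}p /base //|{}p q hp hq IH].
apply: leq_trans (size_polyD _ _) _; rewrite geq_max base //=.
exact: leq_trans (size_scale_leq _ _) IH.
Qed.

(** [split] and [topge] come from [vanishing_split] and [top_index_ge]; the value of [e] will be
    [k - 3]. *)
Hypothesis split : forall p, vanishing Z k.+2 p -> p`_k.+1`_0 = 0 ->
  exists a b, [/\ vanishing Z k.+1 a, vanishing Z k.+1 b & p = a + 'X *: b].
Hypothesis topge : forall p, vanishing Z k.+1 p -> ~ vanishing Z k p ->
  exists2 i, (e <= i <= k)%N & p`_i`_(k - i) != 0.
Variable w : B.
Hypothesis hw : vanishing Z k.+1 w.
Hypothesis nzw : w`_k`_0 != 0.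

(** Every [y p] is an element of the module plus [a y w] with [a] in [F[x]]. When [p] has [y]-degree
    below [k], comparing coefficients of [y^(k+1)] gives [a = 0]. *)
Lemma xspan_muly p : xspan p -> (size p <= k)%N -> xspan (p * 'X).
Proof.
move=> hp sp.
suff [m hm [a ea]] : exists2 m, xspan m & exists a, p * 'X = m + a *: (w * 'X).
  have := congr1 (fun q : B => q`_k.+1) ea; rewrite coefD coefZ !coefMX /=.
  rewrite (nth_default _ sp) (nth_default _ (xspan_size hm)) add0r => /esym/eqP.
  rewrite mulf_eq0 => /orP[/eqP a0|/eqP w0]; first by rewrite ea a0 scale0r addr0.
  by move: nzw; rewrite w0 coef0 eqxx.
have base q : vanishing Z k.+1 q ->
    exists2 m, xspan m & exists a, q * 'X = m + a *: (w * 'X).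
  (* The scalar [c] removes [y^k] from [q - c w], so that [split] applies to its product with
     [y]. *)
  move=> hq; pose c := q`_k`_0 / w`_k`_0.
  have hr : vanishing Z k.+1 (q - c%:P *: w) by apply: vanishing_B => //; apply: vanishing_Z.
  have [|a [b [ha hb eab]]] := split (vanishing_muly hr).
    by rewrite coefMX /= coefB coefZ coefB coefCM divfK // subrr.
  exists (a + 'X *: b); first by apply: xspan_step => //; apply: xspan_base.
  by exists c%:P; rewrite -eab mulrBl -scalerAl subrK.
elim: hp {sp} => [q /base //|q r hq hr [m hm [a ea]]].
have [m' hm' [a' ea']] := base _ hq.
exists (m' + 'X *: m); first by apply: xspanD => //; apply: xspanX.
exists (a' + 'X * a); rewrite mulrDl ea' -scalerAl ea scalerDr scalerDl scalerA.
by rewrite addrACA.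
Qed.

(** In Horner form the tail dominates: if it has a leading term [x^t u], multiplication by [x]
    pushes this above the degree of the new summand; if the tail has degree below [k], it is
    absorbed into a curve of degree at most [k]. *)
Lemma xspan_lead p : xspan p -> vanishing Z k p \/
  exists t u, [/\ vanishing Z k.+1 u, ~ vanishing Z k u & deg_lt (k + t) (p - 'X^t *: u)].
Proof.
have base q : vanishing Z k.+1 q -> vanishing Z k q \/
  exists t u, [/\ vanishing Z k.+1 u, ~ vanishing Z k u & deg_lt (k + t) (q - 'X^t *: u)].
  move=> hq; have [h|h] := boolp.EM (vanishing Z k q); [by left | right].
  by exists 0, q; split=> //; rewrite expr0 scale1r subrr; exact: deg_lt0.
elim=> [q /base //|q r hq hr [hr'|[t [u [h1 h2 h3]]]]].
  by apply: base; apply: vanishing_D => //; apply: vanishing_mulx.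
right; exists t.+1, u; split=> //.
rewrite exprS -scalerA -addrA -scalerBr; apply: deg_ltD.
  by apply: deg_ltW hq.1; lia.
by rewrite addnS; apply: deg_lt_mulx.
Qed.

(* Multiplying by a high power of [x] moves [p] into the second case of [xspan_lead]. *)
Lemma xspan_size_gt p : xspan p -> p != 0 -> (e < size p)%N.
Proof.
have gt q t u : vanishing Z k.+1 u -> ~ vanishing Z k u -> deg_lt (k + t) (q - 'X^t *: u) ->
    (e < size q)%N.
  move=> h1 h2 h3; have [i /andP[ei ik] nz] := topge h1 h2.
  apply: leq_trans (_ : (i < size q)%N); first by [].
  rewrite ltnNge; apply: contra nz => /(nth_default 0) q0.
  have := h3 i (k - i + t)%N; rewrite coefB q0 coefZ sub0r coefN coefXnM.
  rewrite ltnNge leq_addl /= addnK => h.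
  by rewrite -oppr_eq0 h //; lia.
move=> hp p0; have hX : xspan ('X^(k.+1) *: p) by exact: xspanZ.
have X0 : 'X^(k.+1) != 0 :> {poly F} by rewrite expf_neq0 ?polyX_eq0.
rewrite -(size_scale p X0).
case: (xspan_lead hX) => [[h _]|[t [u [h1 h2 h3]]]]; last exact: gt h3.
(* A multiple of [x^(k+1)] of degree below [k] is zero. *)
case/negP: p0; apply/eqP/polyP=> i; apply/polyP=> j.
have := h i (j + k.+1)%N; rewrite coefZ coefXnM ltnNge leq_addl /= addnK => ->.
  by rewrite !coef0.
lia.
Qed.

Lemma common_factor : exists2 G : B, (e < size G)%N &
  forall p, vanishing Z k.+1 p -> exists q, p = q * G.
Proof.
have w0 : w != 0 by apply: contraNneq nzw => ->; rewrite !coef0.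
(* The minimal [s] is one more than the least [y]-degree of a nonzero element. *)
have ex : exists s, boolp.asbool (exists2 G : B, xspan G & G != 0 /\ size G = s).
  by exists (size w); apply/boolp.asboolP; exists w => //; apply: xspan_base.
case: (ex_minnP ex) => s /boolp.asboolP[G hG [G0 sG]] mins.
have hGpow i : (i + s <= k.+1)%N -> xspan (G * 'X^i).
  elim: i => [|i IH] le; first by rewrite mulr1.
  rewrite exprSr mulrA; apply: xspan_muly; first by apply: IH; lia.
  rewrite size_mulXn // sG; lia.
have hGmul (q : B) : (size q + s <= k.+2)%N -> xspan (q * G).
  move=> le; rewrite -[q]coefK poly_def mulr_suml.
  apply: (big_ind xspan); [exact/xspan_base/vanishing_0 | exact: xspanD |].
  move=> i _; rewrite -scalerAl mulrC; apply: xspanZ; apply: hGpow.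
  have := ltn_ord i; lia.
have [a [G' [a0 prG' eG]]] := exists_primitive G0.
exists G'.
  by rewrite -(size_scale G' a0) -eG; apply: xspan_size_gt.
move=> p hp; have hMp : xspan p by apply: xspan_base.
have s0 : (0 < s)%N by rewrite -sG size_poly_gt0.
(* Pseudo-division in [y]: the remainder is an [F[x]]-combination of [p] and of the [y^i G], so it
   lies in the module and minimality of [s] kills it. *)
have rem0 : p %% G = 0.
  apply: boolp.contrapT => /eqP r0.
  suff : (s <= size (p %% G)%R)%N by rewrite leqNgt -sG ltn_modp G0.
  apply: mins; apply/boolp.asboolP; exists (p %% G) => //.
  have -> : p %% G = lead_coef G ^+ scalp p G *: p - p %/ G * G.
    by rewrite Pdiv.Idomain.divp_eq addrC addKr.
  apply: xspanB; first exact: xspanZ.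
  apply: hGmul; rewrite size_divp // sG.
  have := xspan_size hG; rewrite sG; have := xspan_size hMp.
  by move: (size p) => t; lia.
apply: (@primitive_dvd _ (lead_coef G ^+ scalp p G) p (p %/ G * a%:P) G') => //.
  by rewrite expf_neq0 // lead_coef_eq0.
by rewrite Pdiv.Idomain.divp_eq rem0 addr0 {2}eG -mulrA mul_polyC.
Qed.

End CommonFactor.

(** * Two-variable polynomials in sheared coordinates *)

Section Shear.
Variables (F : fieldType) (c : F).
Local Notation B := {poly {poly F}}.
Local Notation P := {mpoly F[2]}.
Implicit Types (p q : P) (b : B).

(** The substitution [x := x + c y] preserves degree bounds, and a generic [c] makes a pure power of
    [y] appear. *)
Definition shear_gen (i : 'I_2) : B :=
  if i == 0 then 'X%:P + c%:P%:P * 'X else 'X.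

Definition to_poly2 : P -> B := mmap (polyC \o polyC) shear_gen.
HB.instance Definition _ := GRing.RMorphism.on to_poly2.

(** Half of the inverse substitution: the inner variable goes to [x - c y]; [of_poly2] adds the
    outer one. *)
Definition of_polyx : {poly F} -> P :=
  horner_eval ('X_0 - c *: 'X_1) \o map_poly (@mpolyC 2 F).
HB.instance Definition _ := GRing.RMorphism.on of_polyx.

Definition of_poly2 : B -> P := horner_eval 'X_1 \o map_poly of_polyx.
HB.instance Definition _ := GRing.RMorphism.on of_poly2.

Lemma to_poly2E p : to_poly2 p =
  \sum_(m <- msupp p) (p@_m)%:P%:P * (shear_gen 0 ^+ m 0 * shear_gen 1 ^+ m 1).
Proof.
apply: eq_bigr => m _; rewrite /mmap1 big_ord_recl big_ord1 /=.
by rewrite (_ : lift _ _ = 1) //; apply/val_inj.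
Qed.

Lemma to_poly2X i : to_poly2 'X_i = shear_gen i.
Proof. by rewrite /to_poly2 mmapX mmap1U. Qed.

Lemma to_poly2C a : to_poly2 a%:MP = a%:P%:P.
Proof. exact: mmapC. Qed.

Lemma to_poly2Z a p : to_poly2 (a *: p) = a%:P *: to_poly2 p.
Proof. by rewrite /to_poly2 mmapZ /= mul_polyC. Qed.

Lemma of_polyxX : of_polyx 'X = 'X_0 - c *: 'X_1.
Proof. by rewrite /of_polyx /= map_polyX /horner_eval hornerX. Qed.

Lemma of_polyxC a : of_polyx a%:P = a%:MP.
Proof. by rewrite /of_polyx /= map_polyC /horner_eval hornerC. Qed.

Lemma of_poly2X : of_poly2 'X = 'X_1.
Proof. by rewrite /of_poly2 /= map_polyX /horner_eval hornerX. Qed.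

Lemma of_poly2C a : of_poly2 a%:P = of_polyx a.
Proof. by rewrite /of_poly2 /= map_polyC /horner_eval hornerC. Qed.

Lemma of_poly2K : cancel of_poly2 to_poly2.
Proof.
have Kx a : to_poly2 (of_polyx a) = a%:P.
  elim/poly_ind: a => [|a d IH]; first by rewrite !rmorph0.
  rewrite !rmorphD !rmorphM /= IH of_polyxX of_polyxC to_poly2C.
  rewrite rmorphB /= to_poly2Z !to_poly2X /shear_gen /=.
  by rewrite -mul_polyC addrK.
elim/poly_ind => [|b a IH]; first by rewrite !rmorph0.
rewrite !rmorphD !rmorphM /= IH of_poly2X of_poly2C Kx to_poly2X.
by rewrite /shear_gen.
Qed.

Lemma to_poly2K : cancel to_poly2 of_poly2.
Proof.
move=> p; rewrite to_poly2E rmorph_sum /= [RHS]mpolyE.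
apply: eq_bigr => m _; rewrite !rmorphM !rmorphXn /= of_poly2C of_polyxC.
rewrite /shear_gen /= rmorphD rmorphM /= !of_poly2C of_poly2X of_polyxX of_polyxC.
rewrite mul_mpolyC mul_mpolyC subrK; congr (_ *: _).
rewrite -[RHS]mmap1_id /mmap1 big_ord_recl big_ord1 /=.
by rewrite (_ : lift _ _ = 1) //; apply/val_inj.
Qed.

Lemma mdeg2 (m : 'X_{1..2}) : mdeg m = (m 0%R + m 1%R)%N.
Proof.
rewrite mdegE big_ord_recl big_ord1; congr (_ + m _)%N; exact/val_inj.
Qed.

Lemma deg_lt_exp d (b : B) t : deg_lt d.+1 b -> deg_lt (t * d).+1 (b ^+ t).
Proof.
move=> hb; elim: t => [|t IH]; last by rewrite exprS mulSn; apply: deg_ltM.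
by rewrite expr0 => i j h; rewrite coef1; case: i h => [|i] h /=; rewrite ?coef0 // coef1; case: j h.
Qed.

Lemma deg_lt_shear_gen i : deg_lt 2 (shear_gen i).
Proof.
have tX : deg_lt 2 ('X : B).
  by move=> u v h; rewrite coefX; case: eqP => [e|_]; rewrite ?coef0 // coef1; case: eqP => //; lia.
rewrite /shear_gen; case: ifP => // _; apply: deg_ltD; last by rewrite mul_polyC; apply: deg_ltZ.
move=> u v h; rewrite coefC; case: eqP => [e|_]; rewrite ?coef0 // coefX.
by case: eqP => //; lia.
Qed.

Lemma deg_lt_to_poly2 m p : (msize p <= m)%N -> deg_lt m (to_poly2 p).
Proof.
move=> le; rewrite to_poly2E big_seq; apply: (big_ind (deg_lt m)).
- exact: deg_lt0.
- exact: deg_ltD.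
move=> mo /msize_mdeg_lt lt; rewrite mul_polyC; apply: deg_ltZ.
have t0 := @deg_lt_exp 1 _ (mo 0) (deg_lt_shear_gen 0).
have t1 := @deg_lt_exp 1 _ (mo 1) (deg_lt_shear_gen 1).
have := deg_ltM t0 t1; rewrite !muln1 -mdeg2; apply: deg_ltW.
exact: leq_trans lt le.
Qed.

Lemma msizeM_leq d d' p q : (msize p <= d.+1)%N -> (msize q <= d'.+1)%N ->
  (msize (p * q) <= (d + d').+1)%N.
Proof.
have [->|p0] := eqVneq p 0; first by rewrite mul0r msize0.
have [->|q0] := eqVneq q 0; first by rewrite mulr0 msize0.
rewrite msizeM //; move: (msize p) (msize q) => u v; lia.
Qed.

Lemma msize_exp_leq d p t : (msize p <= d.+1)%N -> (msize (p ^+ t) <= (t * d).+1)%N.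
Proof.
move=> h; elim: t => [|t IH]; first by rewrite expr0 msize1.
by rewrite exprS mulSn; apply: msizeM_leq.
Qed.

Lemma msize_big_leq (I : Type) (r : seq I) (Q : pred I) (f : I -> P) d :
  (forall i, Q i -> (msize (f i) <= d)%N) -> (msize (\sum_(i <- r | Q i) f i) <= d)%N.
Proof.
move=> h; apply: (big_ind (fun p => msize p <= d)%N) => //; first by rewrite msize0.
by move=> p q hp hq; apply: leq_trans (msizeD_le _ _) _; rewrite geq_max hp.
Qed.

Lemma msizeX1 i : msize ('X_i : P) = 2.
Proof. by rewrite msizeX mdeg1. Qed.

Lemma msize_of_poly2 m b : deg_lt m b -> (msize (of_poly2 b) <= m)%N.
Proof.
move=> hb; rewrite -[b]coefK poly_def rmorph_sum; apply: msize_big_leq => i _.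
rewrite -mul_polyC rmorphM rmorphXn /= of_poly2X of_poly2C.
rewrite -[b`_i]coefK poly_def rmorph_sum mulr_suml; apply: msize_big_leq => j _.
rewrite -mul_polyC rmorphM rmorphXn /= of_polyxX of_polyxC mul_mpolyC -scalerAl.
have [e|ne] := eqVneq b`_i`_j 0; first by rewrite e scale0r msize0.
apply: leq_trans (msizeZ_le _ _) _.
have hu : (msize (('X_0 - c *: 'X_1)%R : P) <= 2)%N.
  apply: leq_trans (msizeD_le _ _) _; rewrite geq_max msizeX1 msizeN.
  by rewrite (leq_trans (msizeZ_le _ _)) // msizeX1.
have h1 : (msize ('X_1%R : P) <= 2)%N by rewrite msizeX1.
apply: leq_trans (msizeM_leq (@msize_exp_leq 1 _ j hu) (@msize_exp_leq 1 _ i h1)) _.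
by rewrite !muln1 addnC ltnNge; apply: contra ne => /hb ->.
Qed.

Lemma deg_lt_to_poly2P m p : deg_lt m (to_poly2 p) <-> (msize p <= m)%N.
Proof.
split; last exact: deg_lt_to_poly2.
by move/msize_of_poly2; rewrite to_poly2K.
Qed.

(** Nodes move by the inverse substitution, so that values are preserved ([ev2_to_poly2]). *)
Definition shear_pt (x : 'rV[F]_2) : F * F := (x 0 0 - c * x 0 1, x 0 1).

Lemma shear_pt_inj : injective shear_pt.
Proof.
move=> x y [e0 e1]; rewrite e1 in e0; move/addIr: e0 => e0.
apply/rowP=> i; case: i => -[|[|//]] h.
  by have -> : Ordinal h = 0 by apply/val_inj.
by have -> : Ordinal h = 1 by apply/val_inj.
Qed.

Lemma ev2_to_poly2 p x : ev2 (to_poly2 p) (shear_pt x) = p.@[fun i => x 0 i].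
Proof.
pose e : {rmorphism B -> F} := horner_eval (shear_pt x).1 \o horner_eval (shear_pt x).2%:P.
have ee b : ev2 b (shear_pt x) = e b by [].
rewrite ee to_poly2E rmorph_sum /meval /mmap; apply: eq_bigr => m _.
rewrite !rmorphM !rmorphXn /= /mmap1 big_ord_recl big_ord1 /= (_ : lift _ _ = 1); last exact: val_inj.
rewrite /shear_gen /horner_eval /= !hornerE /= /shear_pt /=.
by rewrite subrK.
Qed.

(** After the shear, setting [x = 0] turns [x^a y^b] into [c^a y^(a+b)]; the coefficient of [y^k] is
    thus the degree-[k] form of [p] at [(c, 1)]. *)
Lemma coef_to_poly2 p k : (to_poly2 p)`_k`_0 =
  (\sum_(m <- msupp p | mdeg m == k) p@_m *: 'X^(m 0)).[c].
Proof.
pose at0 : {rmorphism {poly F} -> F} := horner_eval 0.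
have at0C a : at0 a%:P = a by exact: hornerC.
have at0X : at0 'X = 0 by exact: hornerX.
have g0 : map_poly at0 (shear_gen 0) = c%:P * 'X.
  rewrite /shear_gen /= rmorphD rmorphM /= !map_polyC map_polyX /= at0C.
  by rewrite [horner_eval _ _]at0X add0r.
have g1 : map_poly at0 (shear_gen 1) = 'X by rewrite /shear_gen /= map_polyX.
rewrite -horner_coef0 -[LHS](coef_map at0).
rewrite to_poly2E rmorph_sum coef_sum horner_sum [RHS]big_mkcond /=; apply: eq_bigr => m _.
rewrite !rmorphM !rmorphXn /= g0 g1 map_polyC /= [horner_eval _ _]at0C.
rewrite exprMn -mulrA -exprD coefCM -polyC_exp coefCM coefXn mdeg2 eq_sym.
by case: eqP => _; rewrite ?mulr1 ?mulr0 // !hornerE.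
Qed.

End Shear.

Lemma poly_nonroot (F : numFieldType) (p : {poly F}) : p != 0 -> exists c, p.[c] != 0.
Proof.
move=> p0; apply: boolp.contrapT => h.
pose s := [seq i%:R : F | i <- iota 0 (size p)].
have us : uniq s by rewrite map_inj_uniq ?iota_uniq // => i j /eqP; rewrite Num.Theory.eqr_nat => /eqP.
suff : (size s < size p)%N by rewrite size_map size_iota ltnn.
apply: max_poly_roots => //; apply/allP=> x _.
by apply: boolp.contrapT => /negP nr; apply: h; exists x.
Qed.

(** A monomial of degree [k] is determined by its first exponent, so no terms merge in [q] and the
    leading monomial of [p] keeps it nonzero. *)
Lemma generic_shear (F : numFieldType) (p : {mpoly F[2]}) k : msize p = k.+1 ->
  exists c, (to_poly2 c p)`_k`_0 != 0.
Proof.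
move=> sp; have p0 : p != 0 by rewrite -msize_poly_eq0 sp.
set q := \sum_(m <- msupp p | mdeg m == k) p@_m *: 'X^(m 0) : {poly F}.
suff /poly_nonroot[c nz] : q != 0 by exists c; rewrite coef_to_poly2.
have mp := mlead_supp p0; have dm : mdeg (mlead p) = k by apply/eqP; rewrite -eqSS mlead_deg // sp.
apply/eqP => /(congr1 (fun r : {poly F} => r`_(mlead p 0))); rewrite coef0 /q coef_sum => /eqP.
rewrite big_mkcond (bigD1_seq (mlead p)) ?msupp_uniq //= dm eqxx big1 => [|m ne].
  by rewrite addr0 coefZ coefXn eqxx mulr1 mcoeff_eq0 mp.
case: eqP => // dmk; rewrite coefZ coefXn; case: eqP => [e|_]; last by rewrite mulr0.
case/eqP: ne; apply/mnmP => i.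
rewrite -dmk !mdeg2 e in dm; move/addnI: dm => e1.
case: i => -[|[|//]] h.
  by have -> : Ordinal h = 0 by apply/val_inj.
by have -> : Ordinal h = 1 by apply/val_inj.
Qed.

(** * Dimension counts *)

(** Positive gaps [D j.+1 - D j] increase strictly, so after [m] they are at least [a + 1], [a + 2],
    and so on. The second inequality is their sum, doubled to avoid division. *)
Lemma gap_growth (D : nat -> nat) n m a s :
  (forall j, (j < n)%N -> (D j < D j.+1)%N -> (2 * D j.+1 < D j.+2 + D j)%N) ->
  (0 < a)%N -> (D m + a <= D m.+1)%N -> (m + s <= n)%N ->
  (D (m + s) + a + s <= D (m + s).+1)%N /\
  (2 * D m.+1 + 2 * s * a + s * s.+1 <= 2 * D (m + s).+1)%N.
Proof.
move=> G a0 h; elim: s => [|s IH] le; first by rewrite !addn0; split; lia.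
have [IH1 IH2] := IH ltac:(lia).
have := G (m + s)%N ltac:(lia) ltac:(lia); rewrite (addnS m s) => h1.
move: h1 IH1 IH2; move: (D (m + s)%N) (D (m + s).+1) (D (m + s).+2) => x y z h1 IH1 IH2.
split; first lia.
have -> : (2 * s.+1 * a = 2 * s * a + 2 * a)%N by ring.
have -> : (s.+1 * s.+2 = s * s.+1 + 2 * s.+1)%N by ring.
move: (2 * s * a)%N (s * s.+1)%N IH2 => u v IH2; lia.
Qed.

Lemma gap_dim_bound (D : nat -> nat) n k : (4 <= k)%N -> (k < n)%N -> D 0 = 0 ->
  (forall j, D j <= D j.+1)%N ->
  (forall j, (j < n)%N -> (D j < D j.+1)%N -> (2 * D j.+1 < D j.+2 + D j)%N) ->
  (2 * D n.+1 + 6 = (n - k + 4) * (n - k + 5))%N ->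
  (D k.+1 <= 7)%N /\ (D k.+1 = 7 -> D k = 3 /\ D k.+2 = 12)%N.
Proof.
move=> k4 kn D0 mono G En.
(* If the gap at [k] is at least 4, summing the later gaps up to [n] leaves at most 7 for
   [D k.+1]. *)
have [l4|l3] := leqP (D k + 4) (D k.+1).
  have [_ h] := @gap_growth D n k 4 (n - k) G isT l4 ltac:(lia).
  rewrite subnKC in h; last lia.
  have b7 : (D k.+1 <= 7)%N by nia.
  split=> // e7.
  have [l5 _] := @gap_growth D n k 4 1 G isT l4 ltac:(lia).
  rewrite (addn1 k) in l5.
  (* The same sum from [k.+1], with gap at least 5, gives [D k.+2 <= 12]; growth at [k] then forces
     [D k = 3]. *)
  have [_ h'] := @gap_growth D n k.+1 5 (n - k.+1) G isT ltac:(lia) ltac:(lia).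
  rewrite subnKC in h'; last lia.
  have h12 : (D k.+2 <= 12)%N.
    have e : (n - k = (n - k.+1).+1)%N by lia.
    rewrite e in En; nia.
  have := G k kn ltac:(lia); lia.
(* If the gap at [k] is at most 3, the preceding ones are at most 2, 1 and 0, so [D k.+1 <= 6]. *)
have small m a : (m <= k)%N -> (a + (k - m) = 4)%N -> (0 < a)%N -> (D m.+1 < D m + a)%N.
  move=> mk e a0; rewrite ltnNge; apply/negP => h.
  have [h' _] := @gap_growth D n m a (k - m) G a0 h ltac:(lia).
  rewrite subnKC // in h'; lia.
have z j : (j <= k - 2)%N -> D j = 0%N.
  elim: j => // j IH lej; have e := IH ltac:(lia).
  apply/eqP; rewrite -leqn0 leqNgt; apply/negP => h.
  have [h' _] := @gap_growth D n j 1 (k - j) G isT ltac:(lia) ltac:(lia).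
  rewrite subnKC in h'; lia.
have s2 := @small (k - 2)%N 2 ltac:(lia) ltac:(lia) isT.
have s1 := @small (k - 1)%N 3 ltac:(lia) ltac:(lia) isT.
have := z (k - 2)%N (leqnn _).
have e1 : ((k - 2).+1 = k - 1)%N by lia.
have e2 : ((k - 1).+1 = k)%N by lia.
rewrite e1 in s2; rewrite e2 in s1; lia.
Qed.

(** * Passage between independent families of polynomials and dimensions *)

Section Coords.
Variables (R : realType) (c : R) (N : nat).
Local Notation P := {mpoly R[2]}.
Local Notation E := 'M[R]_N.+1.
Implicit Types (X : seq 'rV[R]_2) (p : P) (ps : seq P).

Definition shear_pts X := map (shear_pt c) X.

Lemma vanishing_to_poly2 X m p :
  vanishing (shear_pts X) m (to_poly2 c p) <-> (msize p <= m)%N /\ vanishes_on p X.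
Proof.
split=> -[h1 h2]; split.
- exact: (deg_lt_to_poly2P c m p).1 h1.
- by move=> x hx; rewrite /ev -(ev2_to_poly2 c) h2 // map_f.
- exact: (deg_lt_to_poly2P c m p).2 h1.
- by move=> _ /mapP[x hx ->]; rewrite ev2_to_poly2; apply: h2.
Qed.

Lemma vanishing_of_poly2 X m b : vanishing (shear_pts X) m b ->
  (msize (of_poly2 c b) <= m)%N /\ vanishes_on (of_poly2 c b) X.
Proof. by move=> h; apply/vanishing_to_poly2; rewrite of_poly2K. Qed.

Lemma lin_indep_dim X m ps : (m <= N.+1)%N -> lin_indep ps ->
  (forall p, p \in ps -> (msize p <= m)%N /\ vanishes_on p X) ->
  (size ps <= \dim (vanishing_space N (shear_pts X) m))%N.
Proof.
move=> le li hps.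
pose t : (size ps).-tuple E := [tuple of map (fun p => enc N (to_poly2 c p)) (in_tuple ps)].
have hvan p : p \in ps -> vanishing (shear_pts X) m (to_poly2 c p) by move=> /hps/vanishing_to_poly2.
have ft : free t.
  apply/freeP=> a h0; apply: li.
  apply: (can_inj (to_poly2K c)); rewrite rmorph0 rmorph_sum /=.
  rewrite -[RHS](dec0 R N) -h0 dec_sum; apply: eq_bigr => i _.
  rewrite to_poly2Z decZ (nth_map 0) ?size_tuple // encK //.
  by apply: (deg_ltW le); apply: (hvan _ _).1; rewrite mem_nth.
have := ft; rewrite /free size_tuple => /eqP <-; apply: dimvS.
apply/span_subvP => v /mapP[p hp ->]; apply: vanishing_space_enc => //; exact: hvan.
Qed.

Lemma dim_lin_indep X m : exists ps, [/\ lin_indep ps,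
  size ps = \dim (vanishing_space N (shear_pts X) m) &
  forall p, p \in ps -> (msize p <= m)%N /\ vanishes_on p X].
Proof.
set U := vanishing_space N (shear_pts X) m; pose b := vbasis U.
exists (map (fun A => of_poly2 c (dec A)) b); split.
- move=> a h0 i.
  have fb : free b by apply: basis_free (vbasisP U).
  have sz : size (map (fun A => of_poly2 c (dec A)) b) = \dim U by rewrite size_map size_tuple.
  pose a' (j : 'I_(\dim U)) := a (cast_ord (esym sz) j).
  have -> : i = cast_ord (esym sz) (cast_ord sz i) by apply/val_inj.
  rewrite -/(a' _); move/freeP: fb; apply.
  apply: (@dec_inj R N); rewrite dec0 dec_sum.
  rewrite -[RHS](rmorph0 (to_poly2 c)) -h0 rmorph_sum /=.
  rewrite (reindex (cast_ord sz)) /=; last first.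
    exists (cast_ord (esym sz)) => j _; exact/val_inj.
  apply: eq_bigr => j _; rewrite to_poly2Z decZ /a' /=.
  rewrite (nth_map 0) ?of_poly2K; last first.
    by have := ltn_ord j; rewrite {2}size_map.
  by congr ((a _)%:P *: _); apply/val_inj.
- by rewrite size_map size_tuple.
- move=> _ /mapP[A hA ->]; apply: vanishing_of_poly2; apply/vanishing_spaceP.
  exact: vbasis_mem.
Qed.

End Coords.

Lemma Ndim_bin n : Ndim n = 'C(n.+2, 2).
Proof. by rewrite /Ndim bin2 /= divn2 mulnC. Qed.

Lemma Ndim2 n : (2 * Ndim n = n.+1 * n.+2)%N.
Proof.
rewrite /Ndim mulnC divnK // dvdn2 oddM /=; by case: (odd n).
Qed.

Lemma indep_dim (R : realType) (c : R) n X : uniq X -> n_independent n X ->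
  (\dim (vanishing_space n (shear_pts c X) n.+1) + size X = Ndim n)%N.
Proof.
move=> uX indX; rewrite Ndim_bin -(size_map (shear_pt c) X); apply: dim_vanishing_space_indep => //.
  by rewrite map_inj_uniq //; exact: shear_pt_inj.
move=> _ /mapP[x hx ->]; have [p [hp [hx1 hx0]]] := indX _ hx.
exists (to_poly2 c p); split; first exact: deg_lt_to_poly2.
  by rewrite ev2_to_poly2.
move=> _ /mapP[y hy ->] ne; rewrite ev2_to_poly2; apply: hx0 => //.
by apply: contraNneq ne => ->.
Qed.

Lemma lin_indep_vanishing_le (R : realType) n X (ps : seq {mpoly R[2]}) :
  uniq X -> n_independent n X -> lin_indep ps ->
  (forall p, p \in ps -> inPi n p /\ vanishes_on p X) ->
  (size ps + size X <= Ndim n)%N.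
Proof.
move=> uX iX li h; rewrite -(indep_dim 0 uX iX) leq_add2r.
exact: lin_indep_dim.
Qed.

Lemma exists_lin_indep_vanishing (R : realType) n (X : seq 'rV[R]_2) :
  exists ps : seq {mpoly R[2]}, [/\ lin_indep ps, (Ndim n <= size ps + size X)%N &
    forall p, p \in ps -> inPi n p /\ vanishes_on p X].
Proof.
have [ps [li sz h]] := dim_lin_indep 0 n X n.+1.
exists ps; split=> //; rewrite sz Ndim_bin -(size_map (shear_pt 0) X).
exact: dim_vanishing_space_ge.
Qed.

Lemma lin_indep_mulr (R : realType) (ps : seq {mpoly R[2]}) q : q != 0 ->
  lin_indep ps <-> lin_indep [seq p * q | p <- ps].
Proof.
move=> q0.
have sz : size [seq p * q | p <- ps] = size ps by rewrite size_map.
have sumE (a : 'I_(size [seq p * q | p <- ps]) -> R) :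
  \sum_i a i *: [seq p * q | p <- ps]`_i =
  (\sum_(i < size ps) a (cast_ord (esym sz) i) *: ps`_i) * q.
  rewrite mulr_suml (reindex (cast_ord (esym sz))) /=; last first.
    exists (cast_ord sz) => j _; exact/val_inj.
  by apply: eq_bigr => i _; rewrite (nth_map 0) // scalerAl.
split=> li a h i.
- have -> : i = cast_ord (esym sz) (cast_ord sz i) by apply/val_inj.
  apply: (li (fun i => a (cast_ord (esym sz) i))).
  by apply: (mulIf q0); rewrite mul0r -sumE.
- have -> : i = cast_ord sz (cast_ord (esym sz) i) by apply/val_inj.
  apply: (li (fun i => a (cast_ord sz i))).
  rewrite sumE -[RHS](mul0r q); congr (_ * q); rewrite -[RHS]h.
  by apply: eq_bigr => j _; congr (a _ *: _); apply/val_inj.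
Qed.

Lemma n_independent_sub (R : realType) n (X Y : seq 'rV[R]_2) :
  {subset Y <= X} -> n_independent n X -> n_independent n Y.
Proof.
move=> sub iX A hA; have [p [h1 [h2 h3]]] := iX A (sub _ hA).
by exists p; split=> //; split=> // B hB; apply: h3; apply: sub.
Qed.

Lemma evM (R : realType) (p q : {mpoly R[2]}) x : ev (p * q) x = ev p x * ev q x.
Proof. exact: mevalM. Qed.

Lemma separating_line (R : realType) (A B : 'rV[R]_2) : B != A ->
  exists p, [/\ inPi 1 p, ev p A = 1 & ev p B = 0].
Proof.
move=> ne; have [i nei] : exists i, A 0 i - B 0 i != 0.
  apply: boolp.contrapT => h; case/eqP: ne; apply/rowP=> i.
  by apply: boolp.contrapT => ne; apply: h; exists i; rewrite subr_eq0 eq_sym; exact/eqP.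
exists ((A 0 i - B 0 i)^-1 *: ('X_i - (B 0 i)%:MP)); split.
- apply: leq_trans (msizeZ_le _ _) _; apply: leq_trans (msizeD_le _ _) _.
  by rewrite geq_max msizeX1 msizeN msizeC; case: (_ != 0).
- by rewrite /ev mevalZ mevalB mevalXU mevalC mulVf.
- by rewrite /ev mevalZ mevalB mevalXU mevalC subrr mulr0.
Qed.

(** The fundamental polynomial of [A] is a product of [m] lines, one through each other node and
    none through [A]. *)
Lemma n_independent_small (R : realType) m (Y : seq 'rV[R]_2) :
  uniq Y -> size Y = m.+1 -> n_independent m Y.
Proof.
move=> uY sY A hA.
suff prod s : A \notin s -> exists p, [/\ inPi (size s) p, ev p A = 1 &
    forall B, B \in s -> ev p B = 0].
  have [|p [h1 h2 h3]] := prod (rem A Y); first by rewrite mem_rem_uniqF.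
  exists p; split; first by rewrite size_rem // sY in h1.
  by split=> // B hB ne; apply: h3; rewrite mem_rem_uniq // inE ne.
elim: s => [_|B s IH].
  by exists 1; split=> //; rewrite /inPi ?msize1 // /ev meval1.
rewrite inE negb_or eq_sym => /andP[ne /IH[p [h1 h2 h3]]].
have [l [l1 l2 l3]] := separating_line ne.
exists (l * p); split.
- exact: (msizeM_leq (d := 1) (d' := size s)).
- by rewrite evM l2 h2 mulr1.
- move=> C; rewrite inE => /predU1P[->|hC]; first by rewrite evM l3 mul0r.
  by rewrite evM h3 // mulr0.
Qed.

(** * The bound seven and the case of equality *)

Section Main.
Variables (R : realType) (n k : nat) (X : seq 'rV[R]_2).
Hypotheses (k4 : (4 <= k)%N) (kn : (k < n)%N) (uX : uniq X).
Hypotheses (iX : n_independent n X) (sX : size X = (dnk n (k - 3) + 3)%N).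

(** Independence gives [dim P_n = N_n - d(n,k-3) - 3 = N_(n-k+3) - 3], which is the last hypothesis
    of [gap_dim_bound] after doubling. *)
Lemma curve_dims (c : R) (D := fun j => \dim (vanishing_space n (shear_pts c X) j)) :
  (D k.+1 <= 7)%N /\ (D k.+1 = 7 -> D k = 3 /\ D k.+2 = 12)%N.
Proof.
apply: (@gap_dim_bound D n k) => //.
- by rewrite /D vanishing_space_0 dimv0.
- by move=> j; apply/dimvS/vanishing_space_sub.
- by move=> j; apply: dim_growth.
have := indep_dim c uX iX; rewrite sX /dnk -/(D n.+1).
have := Ndim2 n; have := Ndim2 (n - (k - 3)).
have -> : (n - (k - 3) = n - k + 3)%N by lia.
have : (n - k + 3 <= n)%N by lia.
by move: (n - k)%N => t; rewrite !addnS !addn0; nia.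
Qed.

Lemma curve_dim_le7 (ps : seq {mpoly R[2]}) : lin_indep ps ->
  (forall p, p \in ps -> inPi k p /\ vanishes_on p X) -> (size ps <= 7)%N.
Proof.
move=> li h; apply: leq_trans (curve_dims 0).1.
by apply: lin_indep_dim => //; lia.
Qed.

Section Seven.
Variable ps : seq {mpoly R[2]}.
Hypotheses (s7 : size ps = 7) (li : lin_indep ps).
Hypothesis hps : forall p, p \in ps -> inPi k p /\ vanishes_on p X.

Lemma seven_dims (c : R) (D := fun j => \dim (vanishing_space n (shear_pts c X) j)) :
  [/\ D k = 3, D k.+1 = 7 & D k.+2 = 12].
Proof.
have [le h] := curve_dims c.
have e : D k.+1 = 7.
  apply/eqP; rewrite eqn_leq le -s7; apply: lin_indep_dim => //; lia.
by have [e3 e12] := h e.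
Qed.

Lemma exists_exact_degree : exists2 p : {mpoly R[2]}, msize p = k.+1 & vanishes_on p X.
Proof.
have [e3 e7 _] := seven_dims 0.
have /subvPn[A /vanishing_spaceP hA nA] :
  ~~ (vanishing_space n (shear_pts 0 X) k.+1 <= vanishing_space n (shear_pts 0 X) k)%VS.
  by apply/negP => /dimvS; rewrite e3 e7.
have [h1 h2] := vanishing_of_poly2 hA.
exists (of_poly2 0 (dec A)) => //; apply/eqP; rewrite eqn_leq h1 ltnNge.
apply: contra nA => le; apply/vanishing_spaceP; split; last exact: hA.2.
by rewrite -(of_poly2K 0 (dec A)); apply/deg_lt_to_poly2P.
Qed.

Lemma seven_common_factor : exists2 q : {mpoly R[2]}, (k - 3 < msize q)%N &
  forall p, inPi k p -> vanishes_on p X -> exists b, p = b * q.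
Proof.
have [p0 sp0 vp0] := exists_exact_degree.
have [c nz] := generic_shear sp0.
pose Z := shear_pts c X; pose w := to_poly2 c p0.
have hw : vanishing Z k.+1 w by apply/vanishing_to_poly2; rewrite sp0.
have [e3 e7 e12] := seven_dims c.
have split := vanishing_split (N := n) kn (Z := Z) _ hw nz.
have {}split : forall p, vanishing Z k.+2 p -> p`_k.+1`_0 = 0 ->
    exists a b, [/\ vanishing Z k.+1 a, vanishing Z k.+1 b & p = a + 'X *: b].
  (* The dimension hypothesis is tight here: [12 + 3 = 2 * 7 + 1]. *)
  by apply: split; rewrite e3 e7 e12.
have topge p : vanishing Z k.+1 p -> ~ vanishing Z k p ->
    exists2 i, (k - 3 <= i <= k)%N & p`_i`_(k - i) != 0.
  move=> hp np; pose Q i := (i <= k)%N && (p`_i`_(k - i) != 0).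
  have exQ : exists i, Q i.
    apply: boolp.contrapT => h; apply: np; split; last exact: hp.2.
    apply: deg_lt_top hp.1 _ => i lei; apply: boolp.contrapT => ne; apply: h.
    by exists i; rewrite /Q lei; exact/eqP.
  have bQ i : Q i -> (i <= k)%N by case/andP.
  case: (ex_maxnP exQ bQ) => i /andP[lei nzi] maxi; exists i => //.
  rewrite lei andbT.
  have := @top_index_ge _ n Z k kn split i p lei hp nzi.
  (* From [3 + (k + 1 - i) <= 7] follows [i >= k - 3]. *)
  rewrite e3 e7 => h; have : (3 + (k.+1 - i) <= 7)%N; last by lia.
  apply: h => i' /andP[lt le]; apply: boolp.contrapT => /eqP ne.
  by have := maxi i'; rewrite /Q le ne => /(_ isT); lia.
have [G sG dG] := common_factor (e := k - 3) split topge hw nz.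
exists (of_poly2 c G).
  rewrite ltnNge; apply/negP => /(deg_lt_to_poly2 c); rewrite of_poly2K => tG.
  have /negP[] : lead_coef G != 0 by rewrite lead_coef_eq0 -size_poly_gt0; lia.
  apply/eqP/polyP=> j; rewrite coef0 lead_coefE tG //.
  by move: (size G) sG => s; lia.
move=> p hp vp; have [|b eb] := dG (to_poly2 c p).
  by apply/vanishing_to_poly2.
by exists (of_poly2 c b); rewrite -[LHS](to_poly2K c) eb rmorphM.
Qed.

Lemma seven_maximal_curve : exists q : {mpoly R[2]},
  has_degree (k - 3) q /\ count (fun x => ev q x != 0) X = 3.
Proof.
have [q sq dq] := seven_common_factor.
have q0 : q != 0 by rewrite -msize_poly_eq0 -lt0n; lia.
have [f ef] : exists f, forall p, p \in ps -> p = f p * q.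
  have /boolp.choice[f hf] : forall p, exists b, p \in ps -> p = b * q.
    move=> p; have [hp|_] := boolP (p \in ps); last by exists 0.
    by have [h1 h2] := hps hp; have [b eb] := dq p h1 h2; exists b.
  by exists f.
pose bs := map f ps.
have ebs : ps = [seq b * q | b <- bs].
  by rewrite -map_comp -[LHS]map_id; apply/eq_in_map => p /ef.
have sbs : size bs = 7 by rewrite size_map.
have lib : lin_indep bs by apply/(lin_indep_mulr _ q0); rewrite -ebs.
have degb b : b \in bs -> inPi (k - (msize q).-1) b.
  case/mapP=> p hp eb; have [h _] := hps hp; rewrite /inPi in h *.
  have [->|b0] := eqVneq b 0; first by rewrite msize0.
  have ep := ef p hp; rewrite -eb in ep.
  move: h; rewrite ep msizeM //; move: (msize b) (msize q) sq => u v; lia.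
(* Seven independent cofactors of degree at most [k - deg q] force [k - deg q >= 3], because
   [N_2 = 6]. Recall that [msize] exceeds the degree by one. *)
have sq3 : msize q = (k - 2)%N.
  have ind0 : n_independent (k - (msize q).-1) ([::] : seq 'rV[R]_2) by [].
  have := @lin_indep_vanishing_le R _ [::] _ isT ind0 lib.
  rewrite sbs addn0 => h.
  have h7 : (7 <= Ndim (k - (msize q).-1))%N by apply: h => p /degb.
  have t3 : (3 <= k - (msize q).-1)%N.
    by have := Ndim2 (k - (msize q).-1); move: (k - _)%N h7 => t h7; nia.
  by move: (msize q) sq t3 => v; lia.
have hq : has_degree (k - 3) q by rewrite /has_degree sq3; lia.
exists q; split=> //.
have e3 : (k - (msize q).-1 = 3)%N by rewrite sq3; lia.
rewrite e3 in degb.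
pose Y := [seq x <- X | ev q x != 0]; pose Y' := [seq x <- X | ev q x == 0].
have vb b : b \in bs -> vanishes_on b Y.
  case/mapP=> p hp -> x; rewrite mem_filter => /andP[nz hx].
  have [_ /(_ x hx)] := hps hp; rewrite (ef p hp) evM => /eqP.
  by rewrite mulf_eq0 (negPf nz) orbF -(ef p hp) => /eqP.
(* The cofactors are cubics vanishing on [Y]; four nodes of [Y] would leave dimension [10 - 4 = 6],
   too small for seven of them. *)
have leY : (size Y <= 3)%N.
  rewrite leqNgt; apply/negP => lt4.
  pose Y4 := take 4 Y.
  have s4 : size Y4 = 4 by rewrite size_takel.
  have uY4 : uniq Y4 by rewrite take_uniq ?filter_uniq.
  have := lin_indep_vanishing_le uY4 (n_independent_small uY4 s4) lib.
  rewrite sbs s4 => h; have : (7 + 4 <= Ndim 3)%N; last by [].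
  apply: h => p hp; split; first exact: degb.
  by move=> x /mem_take; apply: vb.
have sum : (size Y + size Y' = size X)%N.
  by rewrite !size_filter addnC -(count_predC (fun x => ev q x == 0)).
have iY' : n_independent n Y'.
  by apply: n_independent_sub iX => x; rewrite mem_filter => /andP[].
have uY' : uniq Y' by rewrite filter_uniq.
(* The [N_(n-k+3)] independent multiples of [q] in degree [n] vanish on [Y'], so [q] carries at most
   [d(n,k-3)] nodes and at least three lie off it. *)
have [rs [lir srs hrs]] := exists_lin_indep_vanishing (n - (k - 3)) ([::] : seq 'rV[R]_2).
have := lin_indep_vanishing_le uY' iY' ((lin_indep_mulr rs q0).1 lir).
rewrite size_map => h.
have {}h : (size rs + size Y' <= Ndim n)%N.
  apply: h => _ /mapP[r hr ->]; split.
    have [hr1 _] := hrs r hr.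
    have := msizeM_leq (d := n - (k - 3)) (d' := k - 3) hr1; rewrite /inPi subnK; last lia.
    by apply; rewrite sq3; lia.
  by move=> x; rewrite mem_filter evM => /andP[/eqP -> _]; rewrite mulr0.
rewrite -size_filter -/Y.
have dE : (dnk n (k - 3) + Ndim (n - (k - 3)) = Ndim n)%N.
  rewrite /dnk subnK // !Ndim_bin; apply: leq_bin2l; lia.
rewrite /= addn0 in srs; lia.
Qed.

End Seven.

(** Cubics through the three nodes off [q] form a space of dimension at least [10 - 3]; multiplied
    by [q] they vanish on all of [X]. *)
Lemma maximal_curve_seven (q : {mpoly R[2]}) : has_degree (k - 3) q ->
  count (fun x => ev q x != 0) X = 3 ->
  exists ps : seq {mpoly R[2]}, size ps = 7 /\ lin_indep ps /\
    (forall p, p \in ps -> inPi k p /\ vanishes_on p X).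
Proof.
rewrite /has_degree => /eqP sq cnt.
have q0 : q != 0 by rewrite -msize_poly_eq0 sq.
pose Y := [seq x <- X | ev q x != 0].
have sY : size Y = 3 by rewrite size_filter.
have [rs [li srs hrs]] := exists_lin_indep_vanishing 3 Y.
pose ps := [seq r * q | r <- rs].
have hps p : p \in ps -> inPi k p /\ vanishes_on p X.
  case/mapP=> r /hrs[h1 h2] ->; split.
    have := msizeM_leq (d := 3) (d' := k - 3) h1; rewrite /inPi subnKC; last lia.
    by apply; rewrite sq.
  move=> x hx; rewrite evM; have [->|nz] := eqVneq (ev q x) 0; first by rewrite mulr0.
  by rewrite h2 ?mul0r // mem_filter nz.
have lip : lin_indep ps by exact: (lin_indep_mulr rs q0).1.
exists ps; split; last by split.
(* The family is only known to have at least seven members; the upper bound already proved makes it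
   exactly seven. *)
apply/eqP; rewrite eqn_leq curve_dim_le7 //=.
by rewrite size_map -(leq_add2r 3); move: srs; rewrite sY.
Qed.

End Main.

(** With three nodes off [q], exactly [dnk n (k - 3)] lie on it, so [q] is maximal. *)
Theorem mainTheorem1 (R : realType) (n k : nat) (X : seq 'rV[R]_2) :
  (4 <= k)%N -> (k <= n - 1)%N ->
  uniq X -> n_independent n X ->
  size X = (dnk n (k - 3) + 3)%N ->
  (forall ps : seq {mpoly R[2]},
      lin_indep ps -> (forall p, p \in ps -> inPi k p /\ vanishes_on p X) ->
      (size ps <= 7)%N)
  /\
  ((exists ps : seq {mpoly R[2]},
      size ps = 7%N /\ lin_indep ps /\
      (forall p, p \in ps -> inPi k p /\ vanishes_on p X))
   <->
   (exists q : {mpoly R[2]},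
      has_degree (k - 3) q /\ count (fun x => ev q x != 0) X = 3%N)).
Proof.
move=> k4 kn1 uX iX sX; have kn : (k < n)%N by lia.
split; first exact: curve_dim_le7 kn uX iX sX.
split=> [[ps [s7 [li hps]]]|[q [hq cnt]]].
  exact: (seven_maximal_curve k4 kn uX iX sX s7 li hps).
exact: (maximal_curve_seven k4 kn uX iX sX hq cnt).
Qed.
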